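(* Let $G$ be a finite solvable group. Then $\ell_{\mathbf{F}}(G)\leq |\mathrm{cod}(G)|-1$.
   Context: All characters are complex; $\mathrm{Irr}(G)$ is the set of irreducible complex characters of $G$. For $\chi\in\mathrm{Irr}(G)$, the codegree of $\chi$ is $\mathrm{cod}(\chi)=|G:\ker(\chi)|/\chi(1)$, where $\ker(\chi)=\{g\in G:\chi(g)=\chi(1)\}$, and $\mathrm{cod}(G)=\{\mathrm{cod}(\chi):\chi\in\mathrm{Irr}(G)\}$ is the set (without multiplicity) of irreducible character codegrees. $\ell_{\mathbf{F}}(G)$ denotes the Fitting height of the solvable group $G$: the least $n\geq 0$ with $\mathbf{F}_n(G)=G$, where $\mathbf{F}_0(G)=1$ and $\mathbf{F}_{i+1}(G)/\mathbf{F}_i(G)=\mathbf{F}(G/\mathbf{F}_i(G))$, with $\mathbf{F}(\cdot)$ the Fitting subgroup (largest nilpotent normal subgroup). In particular $\ell_{\mathbf{F}}(1)=0$. *)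

(* Defs.v *)
From mathcomp Require Import all_boot all_order all_algebra.
From mathcomp Require Import all_fingroup all_solvable all_field all_character.

Set Implicit Arguments.
Unset Strict Implicit.
Unset Printing Implicit Defensive.

Import GroupScope GRing.Theory.

Section Codegrees.

Variables (gT : finGroupType) (G : {group gT}).

(* For irreducible phi, cfkerEirr identifies cfker phi with
   {g | phi g = phi 1}. *)
Definition codegree (phi : 'CF(G)) : algC :=
  (#|G : cfker phi|%:R / phi 1%g)%R.

Definition cod : seq algC := undup [seq codegree chi | chi <- irr G].

End Codegrees.

Arguments codegree {gT G} phi%_CF.
Arguments cod {gT} G%_G.

Section FittingHeight.

Variable gT : finGroupType.
Implicit Types G : {group gT}.

Fixpoint fitting_series G n : {group gT} :=
  if n is m.+1 then
    [group of coset (fitting_series G m) @*^-1 'F(G / fitting_series G m)]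
  else 1%G.

(* As for nil_class, the search is bounded by #|G|; fitting_heightP shows that
   the bound is harmless when G is solvable.  The value is #|G| if no term
   below the bound equals G. *)
Definition fitting_height G : nat :=
  index G (mkseq (fitting_series G) #|G|).

Lemma fitting_series_normal G n : fitting_series G n <| G.
Proof.
elim: n => [|n IHn] /=; first exact: normal1.
by rewrite -{2}(quotientGK IHn) cosetpre_normal Fitting_normal.
Qed.

Lemma fitting_seriesS_quotient G n :
  fitting_series G n.+1 / fitting_series G n = 'F(G / fitting_series G n).
Proof. exact: cosetpreK. Qed.

Lemma fitting_seriesS_sub G n : fitting_series G n \subset fitting_series G n.+1.
Proof. exact: sub_cosetpre. Qed.

Lemma fitting_series_proper G n :
    solvable G -> fitting_series G n != G ->
  fitting_series G n \proper fitting_series G n.+1.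
Proof.
move=> solG neqG; rewrite properE fitting_seriesS_sub /=.
apply: contra neqG => sFn; have nFG := fitting_series_normal G n.
have: 'F(G / fitting_series G n) == 1.
  by rewrite -fitting_seriesS_quotient; apply/eqP; apply: quotientS1.
rewrite (trivg_Fitting (quotient_sol _ solG)) => /eqP/trivgP.
rewrite quotient_sub1 ?normal_norm // => sGF.
by rewrite -val_eqE /= eqEsubset (normal_sub nFG) sGF.
Qed.

Lemma fitting_heightP G :
    solvable G ->
  fitting_series G (fitting_height G) = G
  /\ (forall n, fitting_series G n = G -> fitting_height G <= n).
Proof.
move=> solG.
have lt_h: G \in mkseq (fitting_series G) #|G|.
  apply/negPn/negP=> notG.
  have neqG n: n < #|G| -> fitting_series G n != G.
    move=> ltn; apply: contra notG => /eqP FnG.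
    by apply/mapP; exists n; rewrite ?mem_iota ?FnG.
  have grow n: n < #|G| -> n < #|fitting_series G n|.
    elim: n => [|n IHn] ltn; first exact: cardG_gt0.
    apply: leq_ltn_trans (IHn (ltnW ltn)) _.
    exact: proper_card (fitting_series_proper solG (neqG _ (ltnW ltn))).
  have lt1: #|G|.-1 < #|G| by rewrite prednK ?cardG_gt0.
  have := grow _ lt1; rewrite prednK ?cardG_gt0 // => leGF.
  have /negP[] := neqG _ lt1.
  by rewrite -val_eqE /= eqEcard leGF (normal_sub (fitting_series_normal _ _)).
have lt_hG: fitting_height G < #|G|.
  by move: lt_h; rewrite -index_mem size_mkseq.
split; first by have := nth_index G lt_h; rewrite -/(fitting_height G) nth_mkseq.
move=> n FnG; rewrite leqNgt; apply/negP=> lt_n.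
have := before_find G lt_n.
by rewrite nth_mkseq ?(ltn_trans lt_n) //= FnG eqxx.
Qed.

End FittingHeight.

Arguments fitting_series {gT} G%_G n%_N.
Arguments fitting_height {gT} G%_G.

(* Main.v *)
Require Import Defs.
From mathcomp Require Import all_boot all_order all_algebra.
From mathcomp Require Import all_fingroup all_solvable all_field all_character.

Set Implicit Arguments.
Unset Strict Implicit.
Unset Printing Implicit Defensive.

Import GroupScope Order.TTheory GRing.Theory Num.Theory.

(** The bound follows by induction on the order of [G], from the inclusion of
    [cod (G / N)] in [cod G]; let [G] be nontrivial.  If some proper quotient
    of [G] has at least the Fitting height of [G], the bound for that quotient
    suffices.  Otherwise every proper quotient has smaller Fitting height, and
    [solvable_monolithic_complement] shows that [G] is then a semidirect product
    [V ><| M], where [V] is a [p]-group and the only minimal normal subgroup of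
    [G].  Two facts are behind this.  If [N1 :&: N2 = 1], the height of [G] is at
    most the larger of the heights of [G / N1] and [G / N2], which makes the
    minimal normal subgroup unique.  Factoring out a normal subgroup contained
    in the Frattini subgroup does not lower the height, so some maximal
    subgroup [M] does not contain [V], and such an [M] is a complement.

    As [V] is nilpotent, the height of [G] is at most one more than that of
    [G / V], so one codegree of [G] outside [cod (G / V)] is enough.  The
    permutation character of [G] on the cosets of [M] has degree [#|V|], and
    its only constituent with [V] in the kernel is the principal character,
    with multiplicity 1.  Since [p] divides [#|V|], another constituent [chi]
    has degree prime to [p] ([sdprod_p'_degree]), and [chi] is faithful because
    [V] lies in every nontrivial normal subgroup.  Hence the full [p]-part of
    [#|G|] divides the codegree of [chi], while codegrees of [G / V] divide
    [#|G / V|]. *)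

(** * Chains with nilpotent factors bound the Fitting height *)

Lemma nilpotent_lcn_sub1 (gT : finGroupType) (G : {group gT}) n :
  'L_n(G) \subset [1 gT] -> nilpotent G.
Proof.
move=> sL1; apply/lcnP; exists n; apply/trivgP.
exact: subset_trans (lcn_subS n G) sL1.
Qed.

(** Phrased with the lower central series, nilpotence of a factor passes to
    preimages and intersections without comparing iterated quotients. *)
Lemma nilpotent_quotientP (gT : finGroupType) (G N : {group gT}) :
  G \subset 'N(N) ->
  reflect (exists n, 'L_n(G) \subset N) (nilpotent (G / N)).
Proof.
move=> nNG; have nNL n := subset_trans (lcn_sub n G) nNG.
apply: (iffP idP) => [/lcnP[n Ln1] | [n sLN]].
  by exists n.+1; rewrite -quotient_sub1 // /quotient morphim_lcn // Ln1.
apply: (@nilpotent_lcn_sub1 _ _ n).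
by rewrite -(morphim_lcn (coset N) n nNG) [coset N @* _]quotientS1.
Qed.

Section NormalChains.

Variable gT : finGroupType.
Implicit Type G : {group gT}.

(** The Fitting series ascends fastest among normal chains with nilpotent
    factors: modulo the [n]-th term, which contains [A n], the image of [A n.+1]
    is a nilpotent normal subgroup. *)
Lemma fitting_series_max G (A : nat -> {group gT}) n :
    A 0 :=: 1 -> (forall i, A i <| G) ->
    (forall i, exists k, 'L_k(A i.+1) \subset A i) ->
  A n \subset fitting_series G n.
Proof.
move=> A1 nsAG nilA; elim: n => [|n IHn] /=; first by rewrite A1.
set F := fitting_series G n in IHn *.
have nsFG: F <| G := fitting_series_normal G n.
have nFA: A n.+1 \subset 'N(F).
  exact: subset_trans (normal_sub (nsAG _)) (normal_norm nsFG).
rewrite -sub_quotient_pre // Fitting_max ?quotient_normal //.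
have [k sLA] := nilA n; apply/nilpotent_quotientP => //.
by exists k; exact: subset_trans sLA IHn.
Qed.

Lemma fitting_height_chain G (A : nat -> {group gT}) n :
    solvable G -> A 0 :=: 1 -> (forall i, A i <| G) ->
    (forall i, exists k, 'L_k(A i.+1) \subset A i) -> A n :=: G ->
  fitting_height G <= n.
Proof.
move=> solG A1 nsAG nilA AnG; apply: (fitting_heightP solG).2.
apply/eqP; rewrite -val_eqE eqEsubset /=.
by rewrite (normal_sub (fitting_series_normal _ _)) -{1}AnG fitting_series_max.
Qed.

Lemma fitting_series_height_leq G n :
  solvable G -> fitting_height G <= n -> fitting_series G n :=: G.
Proof.
move=> solG /subnK <-; elim: (n - _) => [|m IHm].
  by rewrite add0n (fitting_heightP solG).1.
apply/eqP; rewrite eqEsubset (normal_sub (fitting_series_normal _ _)) /=.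
by rewrite -{1}IHm fitting_seriesS_sub.
Qed.

End NormalChains.

Section QuotientHeight.

Variable gT : finGroupType.
Implicit Types G K N : {group gT}.

Definition fitting_cosetpre G N i := (coset N @*^-1 fitting_series (G / N) i)%G.

Lemma fitting_cosetpre0 G N : fitting_cosetpre G N 0 :=: N.
Proof. by rewrite /= -kerE ker_coset. Qed.

Lemma fitting_cosetpre_normal G N i : N <| G -> fitting_cosetpre G N i <| G.
Proof.
move=> nsNG; rewrite -[X in _ <| X](quotientGK nsNG) cosetpre_normal.
exact: fitting_series_normal.
Qed.

Lemma lcn_fitting_cosetpre G N i :
  exists k, 'L_k(fitting_cosetpre G N i.+1) \subset fitting_cosetpre G N i.
Proof.
pose F := fitting_series (G / N).
have nFF: F i.+1 \subset 'N(F i).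
  apply: subset_trans (normal_norm (fitting_series_normal _ i)).
  exact: normal_sub (fitting_series_normal _ _).
have /(nilpotent_quotientP nFF)[k sLF]: nilpotent (F i.+1 / F i).
  by rewrite fitting_seriesS_quotient Fitting_nil.
exists k; rewrite -sub_quotient_pre.
  by rewrite /quotient morphim_lcn ?subsetIl // -/(quotient _ _) cosetpreK.
by apply: subset_trans (lcn_sub _ _) _; apply: subsetIl.
Qed.

Lemma lcn_fitting_cosetpreI G N1 N2 i :
  exists k, 'L_k((fitting_cosetpre G N1 i.+1 :&: fitting_cosetpre G N2 i.+1)%G)
     \subset fitting_cosetpre G N1 i :&: fitting_cosetpre G N2 i.
Proof.
have [k1 sL1] := lcn_fitting_cosetpre G N1 i.
have [k2 sL2] := lcn_fitting_cosetpre G N2 i.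
exists (maxn k1 k2); rewrite subsetI.
rewrite (subset_trans (lcn_sub_leq _ (leq_maxl k1 k2))).
  rewrite (subset_trans (lcn_sub_leq _ (leq_maxr k1 k2))) //.
  by apply: subset_trans sL2; apply: lcnS; apply: subsetIr.
by apply: subset_trans sL1; apply: lcnS; apply: subsetIl.
Qed.

Lemma fitting_cosetpre_id G N n :
    solvable G -> N <| G -> fitting_height (G / N) <= n ->
  fitting_cosetpre G N n :=: G.
Proof.
move=> solG nsNG le_hn; rewrite /= fitting_series_height_leq ?quotient_sol //.
exact: quotientGK.
Qed.

(** The intersections of the pulled back Fitting series of [G / N1] and
    [G / N2] form a chain from [N1 :&: N2] to [G] with nilpotent factors. *)
Lemma fitting_height_subdirect G N1 N2 :
    solvable G -> N1 <| G -> N2 <| G -> N1 :&: N2 = 1 ->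
  fitting_height G <= maxn (fitting_height (G / N1)) (fitting_height (G / N2)).
Proof.
move=> solG nsN1 nsN2 N12_1; set n := maxn _ _.
pose A i := (fitting_cosetpre G N1 i :&: fitting_cosetpre G N2 i)%G.
apply: (@fitting_height_chain _ _ A) => //= [|i|i|].
- by rewrite -!kerE !ker_coset.
- by rewrite normalI ?fitting_cosetpre_normal.
- exact: lcn_fitting_cosetpreI.
have pre1 := fitting_cosetpre_id solG nsN1 (leq_maxl _ _ : _ <= n).
have pre2 := fitting_cosetpre_id solG nsN2 (leq_maxr _ _ : _ <= n).
by move: pre1 pre2; rewrite /= => -> ->; rewrite setIid.
Qed.

(** The pulled back Fitting series of [G / N] starts at [N]; prefixing it with
    the trivial group adds the single factor [N]. *)
Lemma fitting_height_quotient_nil G N :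
    solvable G -> N <| G -> nilpotent N ->
  fitting_height G <= (fitting_height (G / N)).+1.
Proof.
move=> solG nsNG /lcnP[k LN1].
pose A i := if i is j.+1 then fitting_cosetpre G N j else 1%G.
apply: (@fitting_height_chain _ _ A) => // [[|i]|[|i]|].
- exact: normal1.
- exact: fitting_cosetpre_normal.
- exists k.+1; have /= -> := fitting_cosetpre0 G N.
  by rewrite LN1.
- exact: lcn_fitting_cosetpre.
exact: fitting_cosetpre_id.
Qed.

(** For a Sylow subgroup [P] of [K], the image of [P] in [K / N] is
    characteristic, so [P <*> N] is normal in [G] and the Frattini argument gives
    [G = N * 'N_G(P)].  As [N] consists of nongenerators, [P] is normal in [G];
    so every Sylow subgroup of [K] is normal. *)
Lemma nilpotent_mod_Phi G N K :
    N <| G -> K <| G -> N \subset K -> N \subset 'Phi(G) -> nilpotent (K / N) ->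
  nilpotent K.
Proof.
move=> nsNG nsKG sNK sNPhi nilKN.
suffices sKF: K \subset 'F(K) by apply: nilpotentS sKF (Fitting_nil K).
rewrite -{1}(Sylow_gen K) gen_subG; apply/bigcupsP=> P /SylowP[p _ sylP].
have [sPK pP _] := and3P sylP.
rewrite Fitting_max ?(pgroup_nil pP) // /normal sPK /=.
apply: subset_trans (normal_sub nsKG) _.
have nNP: P \subset 'N(N).
  exact: subset_trans sPK (subset_trans (normal_sub nsKG) (normal_norm nsNG)).
have nsPN: P <*> N <| G.
  rewrite joingC -quotientYK // -[X in _ <| X](quotientGK nsNG) cosetpre_normal.
  rewrite (nilpotent_Hall_pcore nilKN (quotient_pHall nNP sylP)).
  by rewrite gFnormal_trans ?quotient_normal.
have sylPN: p.-Sylow(P <*> N) P.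
  by apply: pHall_subl sylP; rewrite ?joing_subl // join_subG sPK.
have defG := Frattini_arg nsPN sylPN.
have /Phi_nongen: 'Phi(G) <*> 'N_G(P) = G.
  apply/eqP; rewrite eqEsubset join_subG Phi_sub subsetIl /=.
  rewrite -{1}defG mul_subG ?joing_subr // join_subG.
  rewrite (subset_trans sNPhi) ?joing_subl // andbT.
  apply: subset_trans (joing_subr _ _); rewrite subsetI normG andbT.
  exact: subset_trans sPK (normal_sub nsKG).
by rewrite genGid => <-; apply: subsetIr.
Qed.

(** By [nilpotent_mod_Phi] the preimage of ['F(G / N)] is itself nilpotent, so
    the trivial group can replace [N] at the bottom of the pulled back Fitting
    series without making the chain longer. *)
Lemma fitting_height_quotient_Phi G N :
    solvable G -> N <| G -> N \subset 'Phi(G) ->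
  fitting_height G <= fitting_height (G / N).
Proof.
move=> solG nsNG sNPhi.
have [-> | ntG] := eqVneq G 1%G.
  by apply: leq_trans (leq0n _); apply: (fitting_heightP (solvable1 _)).2.
have: fitting_height (G / N) != 0.
  apply/eqP=> h0; have: fitting_cosetpre G N 0 :=: G.
    by rewrite fitting_cosetpre_id ?h0.
  rewrite fitting_cosetpre0 => defN.
  by have := Phi_proper ntG; rewrite properE -{3}defN sNPhi andbF.
rewrite -lt0n => /prednK; set n := _.-1 => def_n; rewrite -def_n.
(* Dropping the term N of index 0 needs a term of index 1, hence the proof
   above that the height of G / N is positive. *)
pose A i := if i is j.+1 then fitting_cosetpre G N j.+1 else 1%G.
apply: (@fitting_height_chain _ _ A) => // [[|i]|[|i]|].
- exact: normal1.
- exact: fitting_cosetpre_normal.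
- have sN1: N \subset fitting_cosetpre G N 1 by apply: sub_cosetpre.
  have ns1 := fitting_cosetpre_normal 1 nsNG.
  suffices /lcnP[k L1]: nilpotent (fitting_cosetpre G N 1).
    by exists k.+1; rewrite L1.
  apply: nilpotent_mod_Phi sNPhi _ => //.
  have nN1: fitting_cosetpre G N 1 \subset 'N(N).
    exact: subset_trans (normal_sub ns1) (normal_norm nsNG).
  apply/(nilpotent_quotientP nN1).
  have [k] := lcn_fitting_cosetpre G N 0; rewrite fitting_cosetpre0.
  by exists k.
- exact: lcn_fitting_cosetpre.
by apply: fitting_cosetpre_id => //; rewrite def_n.
Qed.

End QuotientHeight.

(** * Codegrees of quotients and of split extensions *)

Lemma codegree_mod (gT : finGroupType) (G N : {group gT}) (chi : 'CF(G / N)) :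
  N <| G -> codegree (chi %% N) = codegree chi.
Proof.
move=> nsNG; have nsNker: N <| cfker (chi %% N).
  by rewrite (normalS _ _ nsNG) ?cfker_mod ?cfker_sub.
have sNk := normal_sub nsNker; rewrite /codegree cfMod1; congr (_%:R / _)%R.
rewrite -(@index_quotient_eq _ _ N) ?cfker_sub ?normal_norm //.
  by rewrite (quotient_cfker_mod G).
exact: subset_trans (subsetIr _ _) sNk.
Qed.

Lemma cod_quotient (gT : finGroupType) (G N : {group gT}) :
  N <| G -> {subset cod (G / N) <= cod G}.
Proof.
move=> nsNG x; rewrite !mem_undup => /mapP[chi irr_chi ->].
by apply/mapP; exists (chi %% N)%CF; rewrite ?cfMod_irr ?codegree_mod.
Qed.

(** Among the constituents of ['Ind[G, M] 1], whose degree is [#|V|], those with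
    [V] in the kernel are inflated from [M], so by Frobenius reciprocity only
    the principal character occurs, once.  If all others had degree divisible
    by [p], then [#|V|] would be 1 modulo [p]. *)
Lemma sdprod_p'_degree (gT : finGroupType) (p : nat) (G V M : {group gT}) :
    V ><| M = G -> p.-group V -> V :!=: 1 ->
  exists i : Iirr G,
    ~~ (V \subset cfker ('chi_i)%R) /\ ~~ (p %| irr_degree (socle_of_Iirr i)).
Proof.
move=> defG pV ntV; have [nsVG sMG _ _ _] := sdprod_context defG.
pose d (i : Iirr G) := irr_degree (socle_of_Iirr i).
have [pr_p pdvV _] := pgroup_pdiv pV ntV.
suffices /existsP[i /andP[]]:
  [exists i, ~~ (V \subset cfker ('chi_i)%R) && ~~ (p %| d i)] by exists i.
apply: contraT; rewrite negb_exists => /forallP noi.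
have dvd_d i : ~~ (V \subset cfker ('chi_i)%R) -> p %| d i.
  by move=> nVi; have := noi i; rewrite nVi negbK.
have /char_sum_irrP[n defD]: ('Ind[G, M] 1)%R \is a character.
  exact/cfInd_char/cfun1_char.
have nE i: ((n i)%:R = '[(1 : 'CF(M)), 'Res[M] 'chi_i])%R.
  rewrite Frobenius_reciprocity defD cfdot_suml (bigD1 i) //= cfdotZl.
  rewrite cfnorm_irr mulr1 big1 ?addr0 // => j neq_ji.
  by rewrite cfdotZl cfdot_irr (negPf neq_ji) mulr0.
have nV i: V \subset cfker ('chi_i)%R -> n i = (i == 0%R).
  move=> sVi; apply/eqP; rewrite -(eqr_nat algC) nE.
  rewrite -(cfSdprod_iso defG) (cfRes_sdprodK defG) // rmorph1.
  by rewrite -irr0 cfdot_irr (eq_sym i).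
have n0: n 0%R = 1%N by rewrite nV // irr0 cfker_cfun1 normal_sub.
have cardV: #|V| = (\sum_i n i * d i)%N.
  apply/eqP; rewrite -(eqr_nat algC).
  have /cfunP/(_ 1%g) := defD; rewrite cfInd1 // cfun11 mulr1.
  rewrite -divgS // -(sdprod_card defG) mulnK ?cardG_gt0 // => ->.
  rewrite sum_cfunE natr_sum; apply/eqP/eq_bigr=> i _.
  by rewrite cfunE irr1_degree natrM.
have d0: d 0%R = 1%N.
  by apply/eqP; rewrite -(eqr_nat algC) -irr1_degree irr0 cfun11.
have: p %| 1.
  move: pdvV; rewrite cardV (bigD1 0%R) //= n0 d0 dvdn_addl //.
  apply: dvdn_sum => i nz_i.
  have [sVi | ] := boolP (V \subset cfker ('chi_i)%R).
    by rewrite nV // (negPf nz_i).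
  by move/dvd_d/dvdn_mull.
by rewrite dvdn1 => /eqP p1; rewrite p1 in pr_p.
Qed.

(** The character of [sdprod_p'_degree] is faithful, of codegree
    [#|G| / chi 1].  Were this the codegree of [psi], a character of [G / V],
    cross-multiplying would give [chi 1 = #|V| * #|cfker psi| * psi 1], which
    [p] divides. *)
Lemma monolith_new_codegree (gT : finGroupType) (p : nat) (G V M : {group gT}) :
    V ><| M = G -> p.-group V -> V :!=: 1 ->
    (forall N : {group gT}, N <| G -> N :!=: 1 -> V \subset N) ->
  exists2 c, c \in cod G & c \notin cod (G / V).
Proof.
move=> defG pV ntV Vmin; have [i [notVi p'i]] := sdprod_p'_degree defG pV ntV.
have [nsVG _ _ _ _] := sdprod_context defG.
exists (codegree ('chi_i)%R); first by rewrite mem_undup map_f ?mem_irr.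
apply: contra p'i; rewrite mem_undup => /mapP[psi /irrP[j ->]].
have ker1: cfker ('chi_i)%R = 1.
  by apply: contraNeq notVi => /(Vmin _ (cfker_normal _)).
rewrite /codegree ker1 indexg1 !irr1_degree => /eqP.
set di := irr_degree _; set dj := irr_degree _; set K := cfker _.
have [di_gt0 dj_gt0]: 0 < di /\ 0 < dj by rewrite !irr_degree_gt0.
rewrite eqr_div ?pnatr_eq0 -?lt0n // -!natrM eqr_nat.
have [pr_p pdvV _] := pgroup_pdiv pV ntV.
have sKGV: K \subset G / V := cfker_sub _.
rewrite -(Lagrange (normal_sub nsVG)) -card_quotient ?normal_norm //.
rewrite -(Lagrange sKGV) mulnA -mulnAC mulnC eqn_pmul2l ?indexg_gt0 //.
by move/eqP=> <-; rewrite -mulnA dvdn_mulr.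
Qed.

(** * Groups whose proper quotients have smaller Fitting height *)

(** A minimal normal subgroup [V] is an elementary abelian group.  The two
    comparisons of heights with quotients put [V] in every nontrivial normal
    subgroup and leave it outside some maximal subgroup [M].  Then [V * M = G],
    and [V :&: M], normalised by [M] and by the abelian group [V], is normal in
    [G], hence trivial. *)
Lemma solvable_monolithic_complement (gT : finGroupType) (G : {group gT}) :
    solvable G -> G :!=: 1 ->
    (forall N : {group gT}, N <| G -> N :!=: 1 ->
       fitting_height (G / N) < fitting_height G) ->
  exists (p : nat) (V M : {group gT}),
    [/\ V ><| M = G, p.-group V, V :!=: 1
      & forall N : {group gT}, N <| G -> N :!=: 1 -> V \subset N].
Proof.
move=> solG ntG ltG.
have [V minV sVG] := minnormal_exists ntG (normG G).
have [nVG ntV abV] := minnormal_solvable minV sVG solG.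
have [_ minV'] := mingroupP minV.
have nsVG: V <| G by apply/andP.
have notPhi: ~~ (V \subset 'Phi(G)).
  apply/negP=> /(fitting_height_quotient_Phi solG nsVG).
  by rewrite leqNgt ltG.
have mono (N : {group gT}) : N <| G -> N :!=: 1 -> V \subset N.
  move=> nsNG ntN; apply: contraT => notVN.
  have VN1: V :&: N = 1.
    apply: contraNeq notVN => ntVN; apply/setIidPl.
    apply: (minV' (V :&: N)%G); rewrite ?subsetIl //=.
    by rewrite ntVN normal_norm ?normalI.
  have := fitting_height_subdirect solG nsVG nsNG VN1.
  by rewrite leqNgt gtn_max !ltG.
have [M maxM notVM]: exists2 M : {group gT}, maximal M G & ~~ (V \subset M).
  suffices /existsP[M /andP[]]:
    [exists M : {group gT}, maximal M G && ~~ (V \subset M)] by exists M.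
  apply: contraR notPhi; rewrite negb_exists => /forallP noM.
  apply/bigcapsP=> M /predU1P[-> // | maxM].
  by have := noM M; rewrite maxM negbK.
have [/proper_sub sMG maxM'] := maxgroupP maxM.
have defG: V * M = G.
  rewrite -norm_joinEr ?(subset_trans sMG) //; apply: contraNeq notVM => neqG.
  rewrite -(maxM' (V <*> M)%G) ?joing_subl ?joing_subr //.
  by rewrite properEneq neqG join_subG sVG.
exists (pdiv #|V|), V, M; split=> //; last exact: abelem_pgroup abV.
apply: (etrans _ defG); apply: sdprodE; first exact: subset_trans sMG nVG.
apply: contraNeq notVM => ntVM.
have nsI: V :&: M <| G.
  rewrite /normal subIset ?sVG //= -{1}defG mul_subG //.
    exact: sub_abelian_norm (abelem_abelian abV) (subsetIl _ _).
  by rewrite normsI ?normG // (subset_trans sMG).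
by apply: subset_trans (mono _ nsI ntVM) (subsetIr _ _).
Qed.

Theorem corollary1p2 (gT : finGroupType) (G : {group gT}) :
  solvable G -> (fitting_height G <= size (cod G) - 1)%N.
Proof.
move=> solG; suffices: fitting_height G < size (cod G).
  by case: (size _) => // m; rewrite subn1.
have [m] := ubnP #|G|; elim: m gT G solG => // m IHm gT G solG /ltnSE leGm.
have [trivG | ntG] := eqVneq G 1%G.
  have codG_gt0: 0 < size (cod G).
    have: codegree ('chi[G]_0)%R \in cod G by rewrite mem_undup map_f ?mem_irr.
    by case: (cod G).
  apply: leq_ltn_trans codG_gt0; apply: (fitting_heightP solG).2.
  by rewrite trivG.
have IHq (N : {group gT}) :
  N <| G -> N :!=: 1 -> fitting_height (G / N) < size (cod (G / N)).
  move=> nsNG ntN; apply: IHm; first exact: quotient_sol.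
  exact: leq_trans (ltn_quotient ntN (normal_sub nsNG)) leGm.
have cod_sub (N : {group gT}) : N <| G -> size (cod (G / N)) <= size (cod G).
  by move=> nsNG; apply: uniq_leq_size (undup_uniq _) (cod_quotient nsNG).
have [/existsP[N /and3P[nsNG ntN leGN]] | noN] :=
  boolP [exists N : {group gT}, [&& N <| G, N :!=: 1
           & fitting_height G <= fitting_height (G / N)]].
  apply: leq_trans (cod_sub N nsNG); apply: leq_ltn_trans leGN _.
  exact: IHq.
have ltG (N : {group gT}) :
  N <| G -> N :!=: 1 -> fitting_height (G / N) < fitting_height G.
  move=> nsNG ntN; rewrite ltnNge; apply: contra noN => leGN.
  by apply/existsP; exists N; rewrite nsNG ntN.
have [p [V [M [defG pV ntV Vmin]]]] :=
  solvable_monolithic_complement solG ntG ltG.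
have [nsVG _ _ _ _] := sdprod_context defG.
have [c Gc notGVc] := monolith_new_codegree defG pV ntV Vmin.
have nilV := pgroup_nil pV.
apply: leq_ltn_trans (fitting_height_quotient_nil solG nsVG nilV) _.
apply: leq_ltn_trans (IHq V nsVG ntV) _.
apply: (@uniq_leq_size _ (c :: cod (G / V))) => [|x].
  by rewrite /= notGVc undup_uniq.
by rewrite inE => /predU1P[-> // | /(cod_quotient nsVG)].
Qed.
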